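(* Let $G$ and $H$ be finite simple graphs, each on $n$ vertices. Let $G'$ and $H'$ be the weighted graphs obtained from $G$ and $H$, respectively, by combining all possible twin vertices (that is, by coalescing every twin class into a single vertex). Suppose that there is some $\alpha>0$ such that $H'$ is isomorphic, as a weighted graph, to $\alpha G'$. Then $G$ and $H$ are cospectral with respect to the normalized Laplacian, i.e. $\mathcal{L}_G$ and $\mathcal{L}_H$ have the same eigenvalues, counting multiplicity.
   Context: A weighted graph is a finite vertex set with nonnegative symmetric edge weights $w(u,v)=w(v,u)$ (with $w(u,v)>0$ exactly when $u\sim v$) and nonnegative vertex weights $w(u)$. A simple graph is the case $w(u,v)\in\{0,1\}$, $w(u,u)=0$, $w(u)=0$. The adjacency matrix is $A_{u,v}=w(u,v)$, the degree is $d(u)=w(u)+\sum_{v\sim u}w(u,v)$, $D$ is the diagonal matrix of degrees, and the normalized Laplacian is $\mathcal{L}=D^{-1/2}(D-A)D^{-1/2}$, where the diagonal entry of $D^{-1/2}$ is set to $0$ at any vertex of degree $0$. In a simple graph two distinct non-isolated vertices are twins if they have the same set of neighbors (in particular, they are not adjacent). Together with equality this is an equivalence relation; its classes are the twin classes (an isolated vertex forms a class by itself). Combining all twin vertices of a simple graph $G$ gives the weighted graph $G'$ whose vertices are the twin classes of $G$, with all vertex weights $0$, no loops, and with $w_{G'}(C,C')=\sum_{u\in C,\,v\in C'}w_G(u,v)$ for distinct classes $C,C'$. For $\alpha>0$, $\alpha G'$ is the weighted graph on the same vertex set with all edge weights and vertex weights multiplied by $\alpha$. An isomorphism of weighted graphs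 is a bijection of vertex sets preserving all edge weights and vertex weights. *)

(* Defs.v *)
From HB Require Import structures.
From mathcomp Require Import all_boot all_order all_algebra.

Set Implicit Arguments.
Unset Strict Implicit.
Unset Printing Implicit Defensive.

Import Order.TTheory GRing.Theory Num.Theory.
Local Open Scope ring_scope.

Record wgraph (R : rcfType) := WGraph {
  wvertex :> finType;
  edge_weight : wvertex -> wvertex -> R;
  vertex_weight : wvertex -> R;
  edge_weight_sym : forall u v, edge_weight u v = edge_weight v u;
  edge_weight_ge0 : forall u v, 0 <= edge_weight u v;
  vertex_weight_ge0 : forall u, 0 <= vertex_weight u }.

(* Loops are allowed: [adjacent u u] holds iff the loop at u has positive
   weight, and that weight is then counted once in [degree u]. *)
Definition adjacent (R : rcfType) (G : wgraph R) (u v : G) : bool :=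
  0 < edge_weight u v.

Definition neighbors (R : rcfType) (G : wgraph R) (u : G) : {set G} :=
  [set v | adjacent u v].

Definition isolated (R : rcfType) (G : wgraph R) (u : G) : bool :=
  neighbors u == set0.

Definition is_simple (R : rcfType) (G : wgraph R) : Prop :=
  [/\ forall u v : G, edge_weight u v = 0 \/ edge_weight u v = 1,
      forall u : G, edge_weight u u = 0
    & forall u : G, vertex_weight u = 0].

Definition degree (R : rcfType) (G : wgraph R) (u : G) : R :=
  vertex_weight u + \sum_(v : G | adjacent u v) edge_weight u v.

(* Matrices are indexed by 'I_#|G|, through the enumeration of the vertices. *)
Definition adjacency_mx (R : rcfType) (G : wgraph R) : 'M[R]_#|G| :=
  \matrix_(i, j) edge_weight (enum_val i : G) (enum_val j : G).

Definition degree_mx (R : rcfType) (G : wgraph R) : 'M[R]_#|G| :=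
  diag_mx (\row_i degree (enum_val i : G)).

Definition degree_inv_sqrt_mx (R : rcfType) (G : wgraph R) : 'M[R]_#|G| :=
  diag_mx (\row_i (if degree (enum_val i : G) == 0 then 0
                   else (Num.sqrt (degree (enum_val i : G)))^-1)).

Definition normalized_laplacian (R : rcfType) (G : wgraph R) : 'M[R]_#|G| :=
  degree_inv_sqrt_mx G *m (degree_mx G - adjacency_mx G)
    *m degree_inv_sqrt_mx G.

(* The matrices compared are real symmetric, so that all their eigenvalues lie
   in R. *)
Definition same_eigenvalues (R : rcfType) (m n : nat)
    (A : 'M[R]_m) (B : 'M[R]_n) : Prop :=
  forall x : R, mup x (char_poly A) = mup x (char_poly B).

Definition cospectral (R : rcfType) (G H : wgraph R) : Prop :=
  same_eigenvalues (normalized_laplacian G) (normalized_laplacian H).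

Definition twin (R : rcfType) (G : wgraph R) (u v : G) : bool :=
  [&& u != v, ~~ isolated u, ~~ isolated v & neighbors u == neighbors v].

Definition twin_or_eq (R : rcfType) (G : wgraph R) : rel G :=
  [rel u v | (u == v) || twin u v].

Definition twin_classes (R : rcfType) (G : wgraph R) : {set {set G}} :=
  equivalence_partition (@twin_or_eq R G) [set: G].

Definition twin_class (R : rcfType) (G : wgraph R) : finType :=
  {C : {set G} | C \in twin_classes G}.

Definition combined_weight (R : rcfType) (G : wgraph R)
    (C C' : twin_class G) : R :=
  if C == C' then 0
  else \sum_(u in val C) \sum_(v in val C') edge_weight u v.

Lemma combined_weight_sym (R : rcfType) (G : wgraph R) (C C' : twin_class G) :
  combined_weight C C' = combined_weight C' C.
Proof.
rewrite /combined_weight eq_sym; case: ifP => // _; rewrite exchange_big /=.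
by apply: eq_bigr => u _; apply: eq_bigr => v _; apply: edge_weight_sym.
Qed.

Lemma combined_weight_ge0 (R : rcfType) (G : wgraph R) (C C' : twin_class G) :
  0 <= combined_weight C C'.
Proof.
rewrite /combined_weight; case: ifP => // _.
by apply: sumr_ge0 => u _; apply: sumr_ge0 => v _; apply: edge_weight_ge0.
Qed.

Definition combine_twins (R : rcfType) (G : wgraph R) : wgraph R :=
  @WGraph R (twin_class G) (@combined_weight R G) (fun=> 0)
    (@combined_weight_sym R G) (@combined_weight_ge0 R G) (fun=> lexx 0).

Definition scale_wgraph (R : rcfType) (a : R) (a_gt0 : 0 < a) (G : wgraph R) :
    wgraph R :=
  @WGraph R G (fun u v => a * edge_weight u v) (fun u => a * vertex_weight u)
    (fun u v => congr1 ( *%R a) (edge_weight_sym u v))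
    (fun u v => mulr_ge0 (ltW a_gt0) (edge_weight_ge0 u v))
    (fun u => mulr_ge0 (ltW a_gt0) (vertex_weight_ge0 u)).

Definition wgraph_isomorphic (R : rcfType) (G H : wgraph R) : Prop :=
  exists f : G -> H,
    [/\ bijective f,
        forall u v : G, edge_weight (f u) (f v) = edge_weight u v
      & forall u : G, vertex_weight (f u) = vertex_weight u].

(* Main.v *)
Require Import Defs.
From HB Require Import structures.
From mathcomp Require Import all_boot all_order all_algebra.
From mathcomp Require Import perm ring.

Set Implicit Arguments.
Unset Strict Implicit.
Unset Printing Implicit Defensive.

Import Order.TTheory GRing.Theory Num.Theory.
Local Open Scope ring_scope.

(** The spectrum of [G] is determined by the size of [G] and by the combined
graph [G']: writing [k] for the number of twin classes,

    char_poly L_G = ('X - 1) ^+ (n - k) * char_poly L_G'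

([char_poly_combine_twins]).  The theorem follows, because [k] and
[char_poly L_G'] depend only on [G'] up to isomorphism
([char_poly_isomorphic]) and scaling: multiplying all weights by [a]
multiplies all degrees by [a], which cancels in
[w(u,v) / (sqrt d(u) * sqrt d(v))] ([normalized_laplacian_scale]).

To compare [L_G] with [L_G'], write [L = E - N], where [E] is the diagonal 0/1
matrix marking the vertices of nonzero degree and [N = D^-1/2 A D^-1/2].  Let
[S] be the matrix with entry [1 / sqrt #|C|] at [(u, C)] when [u] lies in the
class [C], and 0 elsewhere; its columns are orthonormal.  For [u] in [C] and
[v] in [C'], the weight of [(C, C')] in [G'] is [#|C| * #|C'| * w(u,v)] and the
degree of [C] is [#|C| * d(u)], so [N_G = S N_G' S^T]
([normalized_adjacency_class]) and [E_G S = S E_G'] ([support_class_mx]).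
A block determinant computation ([char_poly_intertwine]) turns this into

    char_poly L_G * char_poly E_G' = char_poly E_G * char_poly L_G'.

Finally [char_poly E_G = ('X - 1) ^+ (n - k) * char_poly E_G']: a class with
more than one vertex has nonzero degree, so each of the [n - k] vertices lost
by combining twins contributes the eigenvalue 1. *)

(** * Characteristic polynomials *)

(** A form of Sylvester's identity det (1 + S T) = det (1 + T S) in which 1 is
replaced by intertwined matrices.  With [X = 'X - E] and [X' = 'X - E'], so that
[X S = S X'], multiply the block matrix [[X, -S], [T, 1]] on the right by
[[1, 0], [-T, 1]] and by [[1, S], [0, X']]: both products are triangular. *)
Lemma char_poly_intertwine (R : comNzRingType) (n k : nat) (E : 'M[R]_n)
    (E' : 'M[R]_k) (S : 'M[R]_(n, k)) (T : 'M[R]_(k, n)) :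
  E *m S = S *m E' ->
  char_poly (E - S *m T) * char_poly E' = char_poly E * char_poly (E' - T *m S).
Proof.
move=> ES; rewrite /char_poly /char_poly_mx.
set X := 'X%:M - map_mx polyC E; set X' := 'X%:M - map_mx polyC E'.
set S1 := map_mx polyC S; set T1 := map_mx polyC T.
have XS : X *m S1 = S1 *m X'.
  by rewrite mulmxBl mulmxBr -!map_mxM ES scalar_mxC.
have -> : 'X%:M - map_mx polyC (E - S *m T) = X + S1 *m T1.
  by rewrite map_mxB map_mxM opprB addrA addrAC.
have -> : 'X%:M - map_mx polyC (E' - T *m S) = X' + T1 *m S1.
  by rewrite map_mxB map_mxM opprB addrA addrAC.
pose B := block_mx X (- S1) T1 1%:M.
have detB : \det B = \det (X + S1 *m T1).
  have: \det (B *m block_mx 1%:M 0 (- T1) 1%:M) = \det (X + S1 *m T1).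
    rewrite mulmx_block !mulmx1 !mulmx0 !add0r mulmxN mulNmx opprK mul1mx subrr.
    by rewrite det_ublock det1 mulr1.
  by rewrite det_mulmx det_lblock !det1 !mulr1.
have: \det (B *m block_mx 1%:M S1 0 X') = \det X * \det (X' + T1 *m S1).
  rewrite mulmx_block !mulmx1 !mulmx0 !addr0 mulNmx XS subrr mul1mx.
  by rewrite det_lblock [T1 *m S1 + _]addrC.
by rewrite det_mulmx det_ublock det1 mul1r detB.
Qed.

(** [m] and [n] are kept distinct since two isomorphic graphs yield index types
that are only provably equal. *)
Lemma char_poly_mxsub (R : comNzRingType) (m n : nat) (s : 'I_m -> 'I_n)
    (B : 'M[R]_n) :
  bijective s -> char_poly (mxsub s s B) = char_poly B.
Proof.
move=> bij_s.
have mn : m = n by rewrite -(card_ord m) -(card_ord n) (bij_eq_card bij_s).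
subst m; have inj_s := bij_inj bij_s.
pose p := perm inj_s.
have -> : char_poly (mxsub s s B) =
    \det (row_perm p (col_perm p (char_poly_mx B))).
  congr (\det _); apply/matrixP => i j.
  by rewrite !mxE !permE (inj_eq inj_s).
rewrite row_permE col_permE !det_mulmx !det_perm odd_permV.
by rewrite mulrCA -signr_addb addbb mulr1.
Qed.

Lemma big_enum_val_all (R : Type) (idx : R) (op : Monoid.com_law idx)
    (T : finType) (F : T -> R) :
  \big[op/idx]_(i < #|T|) F (enum_val i) = \big[op/idx]_(x : T) F x.
Proof. by rewrite -big_enum_val; apply: eq_bigl => x; rewrite inE. Qed.

(** * The normalized Laplacian of a weighted graph *)

Section NormalizedLaplacian.

Variables (R : rcfType) (G : wgraph R).
Implicit Types u v : G.

Definition normalized_weight u v : R :=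
  edge_weight u v / (Num.sqrt (degree u) * Num.sqrt (degree v)).

Definition normalized_adjacency_mx : 'M[R]_#|G| :=
  \matrix_(i, j) normalized_weight (enum_val i) (enum_val j).

Definition support_mx : 'M[R]_#|G| :=
  diag_mx (\row_i (degree (enum_val i : G) != 0)%:R).

Lemma degreeE u : degree u = vertex_weight u + \sum_v edge_weight u v.
Proof.
congr (_ + _); rewrite big_mkcond /=; apply: eq_bigr => v _.
rewrite /adjacent lt_def edge_weight_ge0 andbT.
by case: eqP => // ->.
Qed.

Lemma degree_ge0 u : 0 <= degree u.
Proof.
rewrite addr_ge0 ?vertex_weight_ge0// sumr_ge0// => v _.
exact: edge_weight_ge0.
Qed.

Lemma normalized_laplacianE :
  normalized_laplacian G = support_mx - normalized_adjacency_mx.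
Proof.
(* At a vertex of degree 0, the convention 0^-1 = 0 gives the required 0. *)
have isq : degree_inv_sqrt_mx G =
    diag_mx (\row_i (Num.sqrt (degree (enum_val i : G)))^-1).
  congr diag_mx; apply/rowP => i; rewrite !mxE.
  by case: eqP => // ->; rewrite sqrtr0 invr0.
apply/matrixP => i j.
rewrite /normalized_laplacian isq mul_mx_diag mul_diag_mx !mxE.
rewrite mulrBr mulrBl; congr (_ - _); last first.
  by rewrite /normalized_weight invfM -mulrA mulrCA.
case: eqP => [<-|_]; last by rewrite !mulr0n mulr0 mul0r.
rewrite !mulr1n mulrAC -invfM -expr2 sqr_sqrtr ?degree_ge0//.
by case: eqP => [->|/eqP d0]; rewrite ?mulr0 ?mulVf.
Qed.

Lemma char_poly_support_mx :
  char_poly support_mx = \prod_(u : G) ('X - (degree u != 0)%:R%:P).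
Proof.
rewrite char_poly_trig ?diag_mx_is_trig// -[RHS]big_enum_val_all.
by apply: eq_bigr => i _; rewrite !mxE eqxx mulr1n.
Qed.

End NormalizedLaplacian.

Arguments normalized_adjacency_mx {R} G.
Arguments support_mx {R} G.

Lemma char_poly_isomorphic (R : rcfType) (G H : wgraph R) :
  wgraph_isomorphic G H ->
  char_poly (normalized_laplacian G) = char_poly (normalized_laplacian H).
Proof.
move=> [f [bij_f fE fV]].
have fd u : degree (f u) = degree u.
  rewrite !degreeE fV (reindex f) /=; last exact: onW_bij.
  by congr (_ + _); apply: eq_bigr => v _; rewrite fE.
pose s (i : 'I_#|G|) := enum_rank (f (enum_val i)).
have bij_s : bijective s.
  exact: bij_comp (@enum_rank_bij H) (bij_comp bij_f (@enum_val_bij G)).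
rewrite -(@char_poly_mxsub _ _ _ s)//; congr char_poly.
apply/matrixP => i j; rewrite !normalized_laplacianE !mxE /normalized_weight.
by rewrite (bij_eq bij_s) !enum_rankK !fd fE.
Qed.

Lemma normalized_laplacian_scale (R : rcfType) (a : R) (a_gt0 : 0 < a)
    (G : wgraph R) :
  normalized_laplacian (scale_wgraph a_gt0 G) = normalized_laplacian G.
Proof.
have ad (u : G) : degree (u : scale_wgraph a_gt0 G) = a * degree u.
  by rewrite !degreeE mulrDr mulr_sumr.
rewrite !normalized_laplacianE; apply/matrixP => i j.
rewrite !mxE /normalized_weight !ad mulf_eq0 gt_eqF//= !sqrtrM ?ltW//.
rewrite mulrACA -expr2 sqr_sqrtr ?ltW//.
by rewrite -mulf_div divff ?mul1r // gt_eqF.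
Qed.

(** * Twin classes *)

Section TwinClasses.

Variables (R : rcfType) (G : wgraph R).
Hypothesis simpleG : is_simple G.
Implicit Types (u v : G) (C : twin_class G).

Lemma twin_or_eq_equiv :
  {in [set: G] & &, equivalence_rel (@twin_or_eq R G)}.
Proof.
have H u v : twin_or_eq u v = (u == v) ||
    [&& ~~ isolated u, ~~ isolated v & neighbors u == neighbors v].
  by rewrite /twin_or_eq /= /twin; case: eqP.
move=> u v z _ _ _; split; first by rewrite H eqxx.
rewrite !H => /orP[/eqP->//|/and3P[iu iv /eqP nuv]].
rewrite iu iv nuv /=; move: iu iv nuv.
by case: (eqVneq u z) => [->|_]; case: (eqVneq v z) => [->|_] //= iu iv nuv;
  rewrite ?iu ?iv ?nuv ?eqxx.
Qed.

Lemma twin_classes_partition : partition (twin_classes G) [set: G].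
Proof. exact: equivalence_partitionP twin_or_eq_equiv. Qed.

Lemma class_of_subproof u : pblock (twin_classes G) u \in twin_classes G.
Proof.
by apply: pblock_mem; rewrite (cover_partition twin_classes_partition) inE.
Qed.

Definition class_of u : twin_class G :=
  Sub (pblock (twin_classes G) u) (class_of_subproof u).

Lemma mem_twin_class u C : (u \in val C) = (class_of u == C).
Proof.
have tI := partition_trivIset twin_classes_partition.
rewrite -val_eqE /=; apply/idP/eqP => [uC|<-].
  exact: def_pblock tI (valP C) uC.
by rewrite mem_pblock (cover_partition twin_classes_partition) inE.
Qed.

Lemma class_of_eq u v : (class_of u == class_of v) = twin_or_eq u v.
Proof.
rewrite eq_sym -mem_twin_class.
by apply: pblock_equivalence_partition; rewrite ?inE//; exact: twin_or_eq_equiv.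
Qed.

Lemma card_twin_class_gt0 C : (0 < #|val C|)%N.
Proof.
rewrite card_gt0; apply: contraTneq (valP C) => ->.
by have /and3P[] := twin_classes_partition.
Qed.

Lemma twin_weight u u' v v' : class_of u = class_of u' ->
  class_of v = class_of v' -> edge_weight u v = edge_weight u' v'.
Proof.
have W (x y : G) : edge_weight x y = (y \in neighbors x)%:R :> R.
  have [H _ _] := simpleG; rewrite inE /adjacent.
  by case: (H x y) => ->; rewrite ?ltxx ?ltr01.
have nbr (x y : G) : class_of x = class_of y -> neighbors x = neighbors y.
  move/eqP; rewrite class_of_eq => /orP[/eqP->//|].
  by case/and4P => _ _ _ /eqP.
move=> /nbr uu' /nbr vv'.
by rewrite W uu' -W edge_weight_sym W vv' -W edge_weight_sym.
Qed.

(** Twins are not adjacent, so the double sum also gives the right value, 0, on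
the diagonal; this spares a case distinction in degree computations. *)
Lemma combined_weightE C C' :
  combined_weight C C' = \sum_(u in val C) \sum_(v in val C') edge_weight u v.
Proof.
rewrite /combined_weight; case: eqP => // <-; rewrite big1// => u.
rewrite mem_twin_class => /eqP uC; rewrite big1// => v.
rewrite mem_twin_class => /eqP vC.
by rewrite (@twin_weight u u v u) ?uC ?vC//; have [_ ->] := simpleG.
Qed.

Lemma combined_weight_class u v :
  combined_weight (class_of u) (class_of v) =
  #|val (class_of u)|%:R * #|val (class_of v)|%:R * edge_weight u v.
Proof.
rewrite combined_weightE.
under eq_bigr => x xu.
  under eq_bigr => y yv.
    rewrite (@twin_weight x u y v); last first.
    - by apply/eqP; rewrite -mem_twin_class.
    - by apply/eqP; rewrite -mem_twin_class.
    over.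
  rewrite sumr_const; over.
by rewrite sumr_const -[LHS]mulr_natl -[edge_weight u v *+ _]mulr_natl mulrA.
Qed.

Lemma big_twin_class (T : Type) (idx : T) (op : Monoid.com_law idx)
    (F : G -> T) :
  \big[op/idx]_u F u =
  \big[op/idx]_(C : twin_class G) \big[op/idx]_(u in val C) F u.
Proof.
rewrite (partition_big class_of predT)//=.
by apply: eq_bigr => C _; apply: eq_bigl => u; rewrite mem_twin_class.
Qed.

Lemma degree_combine_twins u :
  degree (class_of u : combine_twins G) = #|val (class_of u)|%:R * degree u.
Proof.
transitivity (\sum_C combined_weight (class_of u) C).
  by rewrite degreeE; exact: add0r.
under eq_bigr do rewrite combined_weightE.
rewrite exchange_big mulr_natl -sumr_const; apply: eq_bigr => x.
rewrite mem_twin_class => /eqP xu.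
rewrite degreeE; have [_ _ ->] := simpleG; rewrite add0r.
rewrite -(big_twin_class _ (fun v => edge_weight x v)).
by apply: eq_bigr => v _; apply: twin_weight.
Qed.

Lemma degree_combine_twins_eq0 u :
  (degree (class_of u : combine_twins G) == 0) = (degree u == 0).
Proof.
by rewrite degree_combine_twins mulf_eq0 pnatr_eq0 gtn_eqF ?card_twin_class_gt0.
Qed.

Lemma isolatedE u : isolated u = (degree u == 0).
Proof.
rewrite degreeE; have [_ _ ->] := simpleG; rewrite add0r psumr_eq0; last first.
  by move=> v _; exact: edge_weight_ge0.
apply/eqP/allP => [N v _ | N] /=.
  have: v \notin neighbors u by rewrite N inE.
  by rewrite inE /adjacent -leNgt eq_le edge_weight_ge0 => ->.
apply/setP => v; rewrite !inE /adjacent.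
by have /= /eqP -> := N v (mem_index_enum v); rewrite ltxx.
Qed.

(** Isolated vertices have no twins, so combining preserves their number. *)
Lemma card_isolated_class C :
  degree (C : combine_twins G) == 0 -> #|val C| = 1%N.
Proof.
have /card_gt0P[u uC] := card_twin_class_gt0 C.
move: (uC); rewrite mem_twin_class => /eqP <-.
rewrite degree_combine_twins_eq0 -isolatedE => u0.
apply/eqP/cards1P; exists u; apply/setP => v.
rewrite mem_twin_class class_of_eq inE /twin_or_eq /=.
by rewrite /twin u0 /= !andbF orbF.
Qed.

Lemma sum_card_twin_class : (\sum_(C : twin_class G) #|val C| = #|G|)%N.
Proof.
rewrite -sum1_card (big_twin_class _ (fun=> 1%N)).
by apply: eq_bigr => C _; rewrite sum1_card.
Qed.

(** Both sides are products over the classes: the class [C] contributes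
#|C| factors on the left, one of which comes from [G'].  The other #|C| - 1
factors are all ['X - 1], as a class of degree 0 is a singleton. *)
Lemma char_poly_support_combine_twins :
  char_poly (support_mx G) =
  ('X - 1) ^+ (#|G| - #|twin_class G|)
    * char_poly (support_mx (combine_twins G)).
Proof.
have -> : (#|G| - #|twin_class G| = \sum_(C : twin_class G) #|val C|.-1)%N.
  rewrite -sum_card_twin_class -[X in (_ - X)%N]sum1_card -sumnB.
    by apply: eq_bigr => C _; rewrite subn1.
  by move=> C _; exact: card_twin_class_gt0.
rewrite !char_poly_support_mx -prodrXr -big_split /= big_twin_class.
apply: eq_bigr => C _.
under eq_bigr => u.
  rewrite mem_twin_class => /eqP uC.
  rewrite -degree_combine_twins_eq0 uC; over.
rewrite prodr_const -[in LHS](prednK (card_twin_class_gt0 C)) exprSr.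
by case: eqP => [/eqP/card_isolated_class->|_]; rewrite ?expr0.
Qed.

(** The normalization by [sqrt #|C|] makes the columns orthonormal and keeps the
factorization of the adjacency matrix symmetric, so that the middle factor is
exactly the normalized adjacency matrix of the combined graph. *)
Definition class_mx : 'M[R]_(#|G|, #|combine_twins G|) :=
  \matrix_(i, j) ((class_of (enum_val i) == enum_val j)%:R
                   / Num.sqrt #|val (enum_val j : twin_class G)|%:R).

Lemma class_mx_orthonormal : class_mx^T *m class_mx = 1%:M.
Proof.
apply/matrixP => i j; rewrite !mxE.
pose c (k : 'I_#|combine_twins G|) :=
  Num.sqrt #|val (enum_val k : twin_class G)|%:R : R.
under eq_bigr do rewrite !mxE.
rewrite (big_enum_val_all _ (fun u => (class_of u == enum_val i)%:R / c i
  * ((class_of u == enum_val j)%:R / c j))).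
case: (eqVneq i j) => [<-|ij]; last first.
  rewrite big1// => u _; case: eqP => [->|_]; last by rewrite !mul0r.
  by rewrite (inj_eq enum_val_inj) (negPf ij) mul0r mulr0.
transitivity (\sum_(u in val (enum_val i : twin_class G)) (c i ^+ 2)^-1).
  rewrite [RHS]big_mkcond /=; apply: eq_bigr => u _.
  rewrite mem_twin_class; case: eqP => _; last by rewrite !mul0r.
  by rewrite !mul1r -invfM.
rewrite sumr_const -[LHS]mulr_natl sqr_sqrtr ?ler0n// divff//.
by rewrite pnatr_eq0 -lt0n card_twin_class_gt0.
Qed.

Lemma support_class_mx :
  support_mx G *m class_mx = class_mx *m support_mx (combine_twins G).
Proof.
apply/matrixP => i j; rewrite mul_diag_mx mul_mx_diag !mxE.
case: (class_of _ =P _) => [<-|_]; last by rewrite !mul0r mulr0.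
by rewrite degree_combine_twins_eq0 mulrC.
Qed.

Lemma normalized_weight_class u v :
  normalized_weight u v =
  normalized_weight (class_of u : combine_twins G) (class_of v)
    / (Num.sqrt #|val (class_of u)|%:R * Num.sqrt #|val (class_of v)|%:R).
Proof.
rewrite /normalized_weight !degree_combine_twins /= combined_weight_class.
set a : R := #|val (class_of u)|%:R; set b : R := #|val (class_of v)|%:R.
have a0 : 0 < a by rewrite ltr0n card_twin_class_gt0.
have b0 : 0 < b by rewrite ltr0n card_twin_class_gt0.
rewrite !sqrtrM ?ltW//; set p := Num.sqrt a; set q := Num.sqrt b.
have p0 : p != 0 by rewrite gt_eqF ?sqrtr_gt0.
have q0 : q != 0 by rewrite gt_eqF ?sqrtr_gt0.
rewrite -(sqr_sqrtr (ltW a0)) -(sqr_sqrtr (ltW b0)) -/p -/q !invfM.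
(* The degrees may vanish: their inverse square roots are treated as atoms. *)
move: (_^-1) (_^-1) => x y; field; exact/andP.
Qed.

Lemma normalized_adjacency_class :
  normalized_adjacency_mx G =
  class_mx *m normalized_adjacency_mx (combine_twins G) *m class_mx^T.
Proof.
apply/matrixP => i j; rewrite -mulmxA !mxE.
rewrite (bigD1 (enum_rank (class_of (enum_val i)))) //= big1 ?addr0.
  rewrite !mxE (bigD1 (enum_rank (class_of (enum_val j)))) //= big1 ?addr0.
    rewrite !mxE !enum_rankK !eqxx normalized_weight_class.
    by rewrite !mul1r invfM mulrCA.
  move=> k jk; rewrite !mxE.
  case: (class_of _ =P _) jk => [->|_ _]; last by rewrite mul0r mulr0.
  by rewrite enum_valK eqxx.
move=> k ik; rewrite [class_mx _ _]mxE.
case: (class_of _ =P _) ik => [->|_ _]; last by rewrite !mul0r.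
by rewrite enum_valK eqxx.
Qed.

(** The [n - k] removed copies of the eigenvalue 1 come from the vectors that
sum to 0 on each twin class: the adjacency matrix annihilates them. *)
Lemma char_poly_combine_twins :
  char_poly (normalized_laplacian G) =
  ('X - 1) ^+ (#|G| - #|twin_class G|)
    * char_poly (normalized_laplacian (combine_twins G)).
Proof.
set E' := support_mx (combine_twins G).
have E'0 : char_poly E' != 0 by rewrite monic_neq0 ?char_poly_monic.
apply: (mulIf E'0).
rewrite !normalized_laplacianE {1}normalized_adjacency_class -mulmxA.
rewrite (char_poly_intertwine _ support_class_mx).
rewrite char_poly_support_combine_twins.
rewrite -mulmxA class_mx_orthonormal mulmx1.
exact: mulrAC.
Qed.

End TwinClasses.

Theorem theorem1 (R : rcfType) (n : nat) (G H : wgraph R)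
  (simpleG : is_simple G) (simpleH : is_simple H)
  (cardG : #|G| = n) (cardH : #|H| = n)
  (isoGH : exists (alpha : R) (alpha_gt0 : 0 < alpha),
     wgraph_isomorphic (combine_twins H)
                       (scale_wgraph alpha_gt0 (combine_twins G))) :
  cospectral G H.
Proof.
have [a [a_gt0 iso]] := isoGH.
have eq_classes : #|twin_class H| = #|twin_class G|.
  by have [f [bij_f _ _]] := iso; exact: bij_eq_card bij_f.
move=> x; congr (mup x _).
rewrite (char_poly_combine_twins simpleG) (char_poly_combine_twins simpleH).
rewrite (char_poly_isomorphic iso) (normalized_laplacian_scale a_gt0).
by rewrite eq_classes cardG cardH.
Qed.
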